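(* Let $q$ be a prime power and $N$ a positive integer. There exists a cutting blocking set in $\mathrm{PG}(N,q)$ of size at most $m(q+1)$ which consists of the points of at most $m$ lines, where \[m=\left\lceil \frac{2}{1+\frac{1}{\ln(q)(q+1)^2}}N\right\rceil \text{ if } q>2,\qquad m=\lceil 1.95N\rceil \text{ if } q=2.\]
   Context: $\mathrm{PG}(N,q)$ is the $N$-dimensional projective space over $\mathbb{F}_q$. A cutting blocking set of $\mathrm{PG}(N,q)$ is a point set $S$ such that for every hyperplane $H$, $S\cap H$ spans $H$. *)

(* Defs.v *)
From HB Require Import structures.
From mathcomp Require Import all_boot all_order all_algebra.
From mathcomp Require Import reals exp.

Set Implicit Arguments.
Unset Strict Implicit.
Unset Printing Implicit Defensive.

Import Order.TTheory GRing.Theory Num.Theory.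

Local Open Scope ring_scope.

(* The library leaves {vspace vT} a choiceType; over a finite field it inherits
   finiteness from the matrices that encode subspaces. *)
HB.instance Definition _ (F : finFieldType) (vT : vectType F) :
  isCountable {vspace vT} := CanIsCountable (@VectorInternalTheory.vs2mxK F vT).
HB.instance Definition _ (F : finFieldType) (vT : vectType F) :
  isFinite {vspace vT} := CanIsFinite (@VectorInternalTheory.vs2mxK F vT).

(* The k-dimensional subspaces of PG(N, F) are the vector subspaces of
   F^(N+1) of vector dimension k + 1. *)
Definition pg_subspace (F : finFieldType) (N k : nat) : predArgType :=
  {U : {vspace 'rV[F]_N.+1} | \dim U == k.+1}.

Definition pg_point (F : finFieldType) (N : nat) := pg_subspace F N 0.
Definition pg_line (F : finFieldType) (N : nat) := pg_subspace F N 1.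

(* Only meaningful for 0 < N: a hyperplane has vector dimension N.-1.+1 = N. *)
Definition pg_hyperplane (F : finFieldType) (N : nat) := pg_subspace F N N.-1.

Definition points_of (F : finFieldType) (N k : nat) (U : pg_subspace F N k) :
    {set pg_point F N} :=
  [set P : pg_point F N | (val P <= val U)%VS].

Definition pg_span (F : finFieldType) (N : nat) (S : {set pg_point F N}) :
    {vspace 'rV[F]_N.+1} :=
  (\sum_(P in S) val P)%VS.

Definition cutting_blocking_set (F : finFieldType) (N : nat)
    (S : {set pg_point F N}) : Prop :=
  forall H : pg_hyperplane F N, pg_span (S :&: points_of H) = val H.

Definition line_bound (R : realType) (q N : nat) : int :=
  if q == 2%N then Num.ceil (195 / 100 * N%:R : R)
  else Num.ceil (2 / (1 + 1 / (ln (q%:R : R) * (q%:R + 1) ^+ 2)) * N%:R).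

(* Main.v *)
(* First moment method. A line is drawn as the column span of a uniformly random
   (N+1) x 2 matrix W; degenerate spans are enlarged to lines, which is harmless
   since a superset of a cutting blocking set is one. A union of lines fails to
   be cutting iff for some codimension-2 space ker f :&: ker g inside a
   hyperplane ker f, every drawn line meets ker f within ker g, i.e. every g W
   is a multiple of f W. Since (f W, g W) is a uniform pair of vectors of F^2,
   this has probability (q^3 - q + 1) / q^4 for each line. There are
   (q^(N+1) - 1)(q^(N+1) - q) independent pairs (f, g), and each flag is given
   by (q - 1)^2 q of them, so it suffices that the number of flags times
   ((q^3 - q + 1) / q^4)^m is less than 1. *)
Require Import Defs.
From mathcomp Require Import all_boot all_order all_algebra.
From mathcomp Require Import reals exp.
From mathcomp Require Import ring lra zify.

Import Order.TTheory GRing.Theory Num.Theory.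

Local Open Scope ring_scope.

Set Implicit Arguments.
Unset Strict Implicit.

(** * Dependent and independent pairs of vectors *)

Section Multiples.

Variables (F : finFieldType) (n : nat).
Implicit Types f g : 'rV[F]_n.

(** Read as linear forms, [g] is a multiple of [f] exactly when [g] vanishes wherever [f] does. For
    [f *m W] and [g *m W] this says that the column span of [W] meets the kernel of [f] inside that
    of [g]. *)
Definition multiple_of f g : bool := [exists c, g == c *: f].

Lemma multiple_ofP f g : reflect (exists c, g = c *: f) (multiple_of f g).
Proof. by apply: (iffP existsP) => -[c /eqP]; exists c => //; apply/eqP. Qed.

(** Linear independence, in the form suited to counting: fix a nonzero [f], then discard its
    multiples. *)
Definition indep f g : bool := (f != 0) && ~~ multiple_of f g.

Lemma card_multiple_of f :
  #|[pred g | multiple_of f g]| = if f == 0 then 1%N else #|F|.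
Proof.
case: eqVneq => [->|f0].
  transitivity #|pred1 (0 : 'rV[F]_n)|; last exact: card1.
  apply: eq_card => g; rewrite !inE.
  apply/multiple_ofP/eqP => [[c ->]|->]; first by rewrite scaler0.
  by exists 0; rewrite scaler0.
have scale_inj : injective (fun c : F => c *: f).
  move=> c d /eqP; rewrite -subr_eq0 -scalerBl scaler_eq0 (negPf f0) orbF.
  by rewrite subr_eq0 => /eqP.
rewrite -(card_imset predT scale_inj); apply: eq_card => g.
rewrite !inE; apply/multiple_ofP/imsetP => [[c ->]|[c _ ->]]; by exists c.
Qed.

Lemma card_pairs (T : finType) (P : T -> T -> bool) :
  #|[pred p : T * T | P p.1 p.2]| = (\sum_x #|[pred y | P x y]|)%N.
Proof.
under eq_bigr do rewrite -sum1_card.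
by rewrite pair_big_dep /= -sum1_card; apply: eq_bigl.
Qed.

Lemma card_multiple_pairs :
  #|[pred p : 'rV[F]_n * 'rV[F]_n | multiple_of p.1 p.2]|
  = ((#|F| ^ n - 1) * #|F| + 1)%N.
Proof.
rewrite card_pairs (bigD1 0) //= card_multiple_of eqxx addnC; congr addn.
transitivity (\sum_(f in predC1 (0%R : 'rV[F]_n)) #|F|)%N.
  by apply: eq_bigr => f f0; rewrite card_multiple_of (negPf f0).
by rewrite sum_nat_const cardC1 card_mx mul1n subn1.
Qed.

Lemma card_indep_pairs :
  #|[pred p : 'rV[F]_n * 'rV[F]_n | indep p.1 p.2]|
  = ((#|F| ^ n - 1) * (#|F| ^ n - #|F|))%N.
Proof.
rewrite card_pairs (bigD1 0) //=.
rewrite (eq_card0 (A := [pred g | indep 0 g])) ?add0n; last first.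
  by move=> g; rewrite !inE /indep eqxx.
transitivity (\sum_(f in predC1 (0%R : 'rV[F]_n)) (#|F| ^ n - #|F|))%N.
  apply: eq_bigr => f f0.
  have := cardC [pred g | multiple_of f g]; rewrite card_multiple_of (negPf f0).
  rewrite card_mx mul1n => <-; rewrite addKn.
  by apply: eq_card => g; rewrite !inE /indep f0.
by rewrite sum_nat_const cardC1 card_mx mul1n subn1.
Qed.

Lemma row_free_indep f g : indep f g -> row_free (col_mx f g).
Proof.
case/andP=> f0 /negP gNf; apply: inj_row_free => v.
rewrite -[v]hsubmxK mul_row_col [lsubmx v]mx11_scalar [rsubmx v]mx11_scalar.
set a := lsubmx v 0 0; set b := rsubmx v 0 0; rewrite !mul_scalar_mx => abE.
have [b0|b0] := eqVneq b 0.
  move/eqP: abE; rewrite b0 scale0r addr0 scaler_eq0 (negPf f0) orbF => /eqP->.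
  by rewrite !raddf0 row_mx0.
case: gNf; apply/multiple_ofP; exists (- (b^-1 * a)).
rewrite -[g]scale1r -(mulVf b0) -scalerA.
by rewrite (_ : b *: g = - (a *: f)) ?scalerN ?scalerA ?scaleNr //;
   apply/eqP; rewrite -addr_eq0 addrC abE.
Qed.

End Multiples.

(** * First moment count over tuples of matrices *)

Lemma card_preim_const (T T' : finType) (h : T -> T') (c : nat) (P : pred T') :
  (forall y, #|[pred x | h x == y]| = c) -> #|[pred x | P (h x)]| = (#|P| * c)%N.
Proof.
move=> fiber; rewrite -[LHS]sum1_card (partition_big h P) //= -sum_nat_const.
apply: eq_bigr => y Py; rewrite -(fiber y) -sum1_card; apply: eq_bigl => x.
by rewrite !inE; case: eqP => [->|]; rewrite ?andbF ?andbT.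
Qed.

(* As [f] and [g] are independent, [(f *m W, g *m W)] is uniformly distributed
   when [W] is. *)
Lemma card_multiple_preim (F : finFieldType) (n : nat) (f g : 'rV[F]_n) :
  indep f g ->
  (#|[pred W : 'M[F]_(n, 2) | multiple_of (f *m W) (g *m W)]| * #|F| ^ 4
   = ((#|F| ^ 2 - 1) * #|F| + 1) * #|F| ^ (n * 2))%N.
Proof.
move=> /row_free_indep/row_freeP[B fgB].
pose h (W : 'M[F]_(n, 2)) := (f *m W, g *m W).
pose K := #|[pred W | h W == (0, 0)]|.
have fiber y : #|[pred W | h W == y]| = K.
  (* The right inverse [B] of [col_mx f g] supplies a preimage of [y], so the fibre over [y] is a
     translate of the fibre over zero. *)
  have hB : h (B *m col_mx y.1 y.2) = y.
    have /eq_col_mx[hf hg] : col_mx (f *m (B *m col_mx y.1 y.2))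
                              (g *m (B *m col_mx y.1 y.2)) = col_mx y.1 y.2.
      by rewrite -mul_col_mx mulmxA fgB mul1mx.
    by rewrite /h hf hg; case: (y).
  set W0 := B *m _ in hB.
  rewrite /K -(card_imset _ (addrI (- W0))); apply: eq_card => W; rewrite !inE.
  apply/imsetP/eqP => [[W1]|hW].
    rewrite !inE => /eqP hW1 ->; move: hB; rewrite -hW1 /h !mulmxDr !mulmxN.
    by case=> -> ->; rewrite !addNr.
  exists (W0 + W); last by rewrite addKr.
  rewrite inE -hB; move: hW; rewrite /h !mulmxDr.
  by case=> -> ->; rewrite !addr0.
have := card_preim_const predT fiber.
have := card_preim_const (fun p => multiple_of p.1 p.2) fiber.
rewrite card_multiple_pairs => /= ->.
rewrite (eq_card (B := predT)) // card_mx card_prod card_mx mul1n => ->.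
by rewrite -mulnA -expnD [(K * _)%N]mulnC.
Qed.

(* The pairs [(a f, b g + c f)] are those that give the same flag as [(f, g)]. *)
Lemma leq_card_orbit (F : finFieldType) (n : nat) (B : pred ('rV[F]_n * 'rV[F]_n))
    (f g : 'rV[F]_n) :
  indep f g ->
  (forall a b c : F, a != 0 -> b != 0 -> B (a *: f, b *: g + c *: f)) ->
  ((#|F| - 1) ^ 2 * #|F| <= #|B|)%N.
Proof.
move=> fg closedB; have /row_free_indep/row_free_inj fgI := fg.
have [f0 _] := andP fg.
pose h (p : F * F * F) := (p.1.1 *: f, p.1.2 *: g + p.2 *: f).
have hI : injective h.
  move=> [[a b] c] [[a' b'] c'] [/= /eqP].
  rewrite -subr_eq0 -scalerBl scaler_eq0 (negPf f0) orbF subr_eq0 => /eqP ->.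
  rewrite addrC [b' *: g + _]addrC -!mul_scalar_mx -!mul_row_col.
  move=> /fgI/eq_row_mx[/matrixP/(_ 0 0) + /matrixP/(_ 0 0)].
  by rewrite !mxE /= !mulr1n => -> ->.
pose A := [pred p : F * F * F | (p.1.1 != 0) && (p.1.2 != 0)].
have cardA : #|A| = ((#|F| - 1) ^ 2 * #|F|)%N.
  transitivity #|setX (setX [set~ (0 : F)] [set~ (0 : F)]) [set: F]|.
    by apply: eq_card => p; rewrite !inE andbT.
  by rewrite !cardsX cardsT cardsC1 subn1 expnS expn1.
rewrite -cardA -(card_imset _ hI); apply: subset_leq_card.
by apply/subsetP => _ /imsetP[[[a b] c] /andP[/= a0 b0] ->]; apply: closedB.
Qed.

(** Double counting of the incidences between tuples [W] and their bad pairs. If every [W] had a bad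
    pair, its orbit would give [W] at least [(q - 1) ^ 2 * q] of them, more than the total over all
    independent pairs allows. *)
Lemma exists_cutting_matrices (F : finFieldType) (n m : nat) (q := #|F|) :
  ((q ^ n - 1) * (q ^ n - q) * ((q ^ 2 - 1) * q + 1) ^ m
   < (q - 1) ^ 2 * q * (q ^ 4) ^ m)%N ->
  exists W : {ffun 'I_m -> 'M[F]_(n, 2)}, forall f g : 'rV[F]_n, indep f g ->
    exists i, ~~ multiple_of (f *m W i) (g *m W i).
Proof.
move=> few.
pose bad (W : {ffun 'I_m -> 'M[F]_(n, 2)}) (p : 'rV[F]_n * 'rV[F]_n) :=
  indep p.1 p.2 && [forall i, multiple_of (p.1 *m W i) (p.2 *m W i)].
have [/existsP[W /pred0P Wgood]|/existsPn allbad] :=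
  boolP [exists W, pred0b (bad W)].
  exists W => f g fg; have := Wgood (f, g); rewrite /bad /= fg /= => /negbT.
  by move/forallPn.
have q_gt0 : (0 < q)%N by rewrite ltnW ?card_finNzRing_gt1.
have bad_orbit W : ((q - 1) ^ 2 * q <= #|bad W|)%N.
  have /pred0Pn[[f g] /andP[/= fg /forallP/= fgW]] := allbad W.
  apply: (leq_card_orbit fg) => a b c a0 b0; apply/andP; split=> /=.
    have [f0 gNf] := andP fg; rewrite /indep scaler_eq0 negb_or a0 f0 /=.
    apply: contra gNf => /multiple_ofP[d]; rewrite scalerA => gE.
    apply/multiple_ofP; exists (b^-1 * (d * a - c)).
    by rewrite -scalerA scalerBl -gE addrK scalerA mulVf // scale1r.
  apply/forallP => i; have /multiple_ofP[d gE] := fgW i; apply/multiple_ofP.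
  exists (a^-1 * (b * d + c)); rewrite mulmxDl -!scalemxAl gE !scalerA -scalerDl.
  by rewrite mulrAC mulVf // mul1r.
(* The matrices [W i] vary independently, so the count for one matrix is raised to the power [m];
   the factor [(q ^ 4) ^ m] clears the denominator of the probability. *)
have card_bad p : indep p.1 p.2 ->
    (#|[pred W | bad W p]| * (q ^ 4) ^ m
     = ((q ^ 2 - 1) * q + 1) ^ m * (q ^ (n * 2)) ^ m)%N.
  move=> indp; rewrite -expnMn -(card_multiple_preim indp) expnMn; congr muln.
  set B := [pred W : 'M_(n, 2) | _]; rewrite -[X in (_ ^ X)%N]card_ord.
  rewrite -card_ffun_on; apply: eq_card => W; rewrite !inE /bad indp /=.
  by apply/forallP/ffun_onP.
have count : (#|{ffun 'I_m -> 'M[F]_(n, 2)}| * ((q - 1) ^ 2 * q) <=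
    \sum_(p | indep p.1 p.2) #|[pred W | bad W p]|)%N.
  rewrite -sum_nat_const.
  apply: leq_trans (leq_sum _ (fun W _ => bad_orbit W)) _.
  under eq_bigr do rewrite -sum1_card.
  under [X in (_ <= X)%N]eq_bigr do rewrite -sum1_card.
  rewrite (exchange_big_dep (fun p => indep p.1 p.2)) //=.
  by move=> W p _ /andP[].
have {}count : ((q ^ (n * 2)) ^ m * ((q - 1) ^ 2 * q) * (q ^ 4) ^ m <=
    (q ^ n - 1) * (q ^ n - q) * (((q ^ 2 - 1) * q + 1) ^ m * (q ^ (n * 2)) ^ m))%N.
  move: count; rewrite card_ffun card_ord card_mx => count.
  apply: leq_trans (leq_mul count (leqnn _)) _; apply: eq_leq.
  rewrite big_distrl /= (eq_bigr _ (fun p => @card_bad p)) -card_indep_pairs.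
  by rewrite -sum_nat_const.
have : (0 < (q ^ (n * 2)) ^ m)%N by rewrite !expn_gt0 q_gt0.
move: count few; set Z := ((q ^ (n * 2)) ^ m)%N.
rewrite leqNgt => /negP count few Zgt0; case: count.
by rewrite mulnA -(mulnA Z) (mulnC Z) ltn_mul2r Zgt0.
Qed.

(** * Subspaces, lines and the cutting property *)

(** The map [\1 - projv U] kills [U] but not [v]; any coordinate where the image of [v] is nonzero
    yields [f]. *)
Lemma exists_separating_form (F : fieldType) (n : nat) (U : {vspace 'rV[F]_n})
    (v : 'rV[F]_n) :
  v \notin U ->
  exists f : 'rV[F]_n,
    (forall u, u \in U -> f *m u^T = 0) /\ f *m v^T != 0.
Proof.
move=> vU; pose phi : 'End('rV[F]_n) := (\1 - projv U)%VF.
have /rV0Pn[j phivj] : phi v != 0.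
  apply: contra vU; rewrite !lfun_simp /= subr_eq0 => /eqP->.
  exact: memv_proj.
pose f := (col j (lin1_mx phi))^T.
have fE u : f *m u^T = (phi u 0 j)%:M.
  rewrite /f -trmx_mul -[RHS]tr_scalar_mx; congr trmx.
  rewrite -mul_rV_lin1 colE mulmxA -colE; apply/matrixP => a b.
  by rewrite !ord1 mxE [RHS]mxE eqxx.
exists f; split=> [u uU|]; rewrite fE.
  by rewrite !lfun_simp /= projv_id // subrr mxE raddf0.
by apply: contra phivj => /eqP/matrixP/(_ 0 0); rewrite !mxE eqxx mulr1n => ->.
Qed.

Lemma dimv1_vline (F : fieldType) (vT : vectType F) (U : {vspace vT}) :
  \dim U = 1%N -> exists2 x, x != 0 & U = <[x]>%VS.
Proof.
move=> dimU; have U0 : U != 0%VS by rewrite -dimv_eq0 dimU.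
exists (vpick U); first by rewrite vpick0.
apply/esym/eqP; rewrite eqEdim -memvE memv_pick dimU dim_vline vpick0.
by rewrite U0.
Qed.

(** Append a basis of a complement to a basis of [U] and keep the first [d] vectors; as
    [\dim U <= d], the basis of [U] survives. *)
Lemma exists_intermediate_vspace (F : fieldType) (vT : vectType F) (U : {vspace vT}) (d : nat) :
  (\dim U <= d <= dim vT)%N -> exists2 V : {vspace vT}, (U <= V)%VS & \dim V == d.
Proof.
case/andP=> Ud dT.
have dxUC : directv (U + U^C)%VS by apply/directv_addP; rewrite capv_compl.
have := cat_basis dxUC (vbasisP U) (vbasisP U^C); rewrite addv_complf.
set X := _ ++ _ => basX.
have sizeX : size X = dim vT.
  by rewrite -dimvf -(span_basis basX); apply/esym/eqP; have := basis_free basX.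
exists <<take d X>>%VS.
  rewrite -{1}(span_basis (vbasisP U)) sub_span // => x xU.
  by rewrite take_cat size_tuple ltnNge Ud /= mem_cat xU.
have /catl_free/eqP-> : free (take d X ++ drop d X).
  by rewrite cat_take_drop (basis_free basX).
by rewrite size_takel // sizeX.
Qed.

(** For a basis [b0], [b1] of the line, every point is spanned by [b0] or by some [b1 + c *: b0];
    [h] lists these spans. *)
Lemma card_points_of_line (F : finFieldType) (N : nat) (l : pg_line F N) :
  (#|points_of l| <= #|F|.+1)%N.
Proof.
have [/= X sizeX] : {X : seq _ | size X = 2 & val l = <<X>>%VS}.
  exists (vbasis (val l)); first by rewrite size_tuple (eqP (valP l)).
  exact/esym/span_basis/vbasisP.
case: X sizeX => [|b0 [|b1 []]] //= _.
rewrite span_cons span_seq1 => lE.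
pose h (o : option F) := if o is Some c then <[b1 + c *: b0]>%VS else <[b0]>%VS.
rewrite -card_option -(card_imset _ val_inj) -cardsT.
apply: leq_trans (leq_imset_card h _); apply: subset_leq_card.
apply/subsetP => _ /imsetP[P + ->]; rewrite inE [val l]lE.
have [x x0 ->] := dimv1_vline (eqP (valP P)).
rewrite -memvE => /memv_addP[_ /vlineP[a ->] [_ /vlineP[b ->] xE]].
have same y : x \in <[y]>%VS -> <[x]>%VS = <[y]>%VS.
  move=> xy; apply/eqP; rewrite eqEdim -memvE xy !dim_vline x0.
  by case: (y != 0).
have [b0E|bn0] := eqVneq b 0.
  apply/imsetP; exists None => //=; apply: same; apply/vlineP; exists a.
  by rewrite xE b0E scale0r addr0.
apply/imsetP; exists (Some (b^-1 * a)) => //=; apply: same; apply/vlineP.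
by exists b; rewrite scalerDr scalerA mulVKf // addrC.
Qed.

Lemma dim_rV (F : fieldType) (n : nat) : dim 'rV[F]_n = n.
Proof. by rewrite -[LHS]/(1 * n)%N mul1n. Qed.

(** The columns of [W] span at most two dimensions, and [0 < N] leaves room to enlarge their span to
    exactly two. *)
Lemma line_containing (F : finFieldType) (N : nat) (W : 'M[F]_(N.+1, 2)) :
  (0 < N)%N -> exists l : pg_line F N, forall w : 'cV[F]_2, (W *m w)^T \in val l.
Proof.
move=> N_gt0; pose X := [seq row i W^T | i : 'I_2].
have [|l Xl diml] := @exists_intermediate_vspace F 'rV[F]_N.+1 <<X>>%VS 2.
  rewrite (leq_trans (dim_span _)) /=; last by rewrite size_map size_enum_ord.
  by rewrite dim_rV.
exists (exist _ l diml) => w /=; apply: (subvP Xl).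
rewrite trmx_mul mulmx_sum_row; apply: memv_suml => i _; apply: memvZ.
by apply: memv_span; apply: image_f.
Qed.

(** Suppose the span [U] misses some [h] in [H]. Take [f] with kernel [H], and [g] vanishing on [U]
    but not at [h]. Some [W i] then yields a point of [S] in [H] where [g] is nonzero, although it
    must lie in [U]. *)
Lemma cutting_of_matrices (F : finFieldType) (N m : nat)
    (W : {ffun 'I_m -> 'M[F]_(N.+1, 2)}) (S : {set pg_point F N}) :
  (0 < N)%N ->
  (forall f g : 'rV[F]_N.+1, indep f g ->
    exists i, ~~ multiple_of (f *m W i) (g *m W i)) ->
  (forall (i : 'I_m) (w : 'cV[F]_2) (P : pg_point F N),
     (val P <= <[(W i *m w)^T]>)%VS -> P \in S) ->
  cutting_blocking_set S.
Proof.
move=> N_gt0 cutW linesS H; set U := pg_span _.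
have dimH : \dim (val H) = N by rewrite (eqP (valP H)) prednK.
have UH : (U <= val H)%VS by apply/subv_sumP => P; rewrite !inE => /andP[].
apply/eqP; rewrite eqEsubv UH /=; apply/negPn/negP => /subvPn[h hH hU].
have /subvPn[v _ vH] : ~~ ({:'rV[F]_N.+1} <= val H)%VS.
  by apply/negP => /dimvS; rewrite dimvf dimH dim_rV ltnn.
have [f [fH fv]] := exists_separating_form vH.
have [g [gU gh]] := exists_separating_form hU.
(* [H] has codimension one, so adding [v] fills the space, and [f] vanishes on [H] but not at
   [v]. *)
have kerf x : f *m x^T = 0 -> x \in val H.
  move=> fx; have : x \in (val H + <[v]>)%VS.
    suff -> : (val H + <[v]> = fullv)%VS by exact: memvf.
    apply/eqP; rewrite eqEdim subvf dimvf dim_rV /= dimv_disjoint_sum.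
      rewrite dimH dim_vline; case: eqP vH => [->|]; rewrite ?mem0v //.
      by rewrite addn1.
    apply/eqP; rewrite -subv0; apply/subvP => y /memv_capP[yH /vlineP[c yE]].
    rewrite memv0 yE scaler_eq0; case: eqVneq => //= c0.
    by case/negP: vH; rewrite -(scale1r v) -(mulVf c0) -scalerA -yE memvZ.
  move=> /memv_addP[y yH [_ /vlineP[c ->] xE]].
  move: fx; rewrite xE linearD linearZ /= mulmxDr fH // add0r -scalemxAr.
  move/eqP; rewrite scaler_eq0 (negPf fv) orbF => /eqP ->.
  by rewrite scale0r addr0.
have fg : indep f g.
  apply/andP; split; first by apply: contraNneq fv => ->; rewrite mul0mx.
  apply: contra gh => /multiple_ofP[c ->].
  by rewrite -scalemxAl fH // scaler0.
have [i Wi] := cutW _ _ fg.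
(* Separation is applied once more, in [F^2]: [g *m W i] lies off the span of [f *m W i]. *)
have [w fw gw] : exists2 w : 'cV[F]_2, f *m W i *m w = 0 & g *m W i *m w != 0.
  have [] := @exists_separating_form _ _ <[f *m W i]>%VS (g *m W i).
    apply: contra Wi => /vlineP[c gE]; apply/multiple_ofP; by exists c.
  move=> w [fw gw]; exists w^T; last by rewrite -trmx_eq0 trmx_mul trmxK.
  by apply: trmx_inj; rewrite trmx_mul trmxK fw ?trmx0 ?memv_line.
pose x := (W i *m w)^T.
have fx : f *m x^T = 0 by rewrite trmxK mulmxA.
have gx : g *m x^T != 0 by rewrite trmxK mulmxA.
have x0 : x != 0 by apply: contraNneq gx => ->; rewrite trmx0 mulmx0.
have dimx : \dim <[x]> == 1%N by rewrite dim_vline x0.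
suff xU : x \in U by rewrite gU ?eqxx in gx.
rewrite memvE.
have PS : (exist _ <[x]>%VS dimx : pg_point F N) \in S :&: points_of H.
  by rewrite !inE (linesS i w) //= -memvE kerf.
exact: (sumv_sup _ PS).
Qed.

(** * Numerical estimates for the number of lines *)

Lemma line_bound2_count (N m : nat) :
  (0 < N)%N -> (39 * N <= 20 * m)%N ->
  ((2 ^ N.+1 - 1) * (2 ^ N.+1 - 2) * ((2 ^ 2 - 1) * 2 + 1) ^ m
   < (2 - 1) ^ 2 * 2 * (2 ^ 4) ^ m)%N.
Proof.
move=> N_gt0 mN.
suff pow_lt : ((2 ^ N.+1 - 1) * (2 ^ N - 1) * 7 ^ m < 16 ^ m)%N.
  have -> : (2 ^ N.+1 - 2 = 2 * (2 ^ N - 1))%N by rewrite mulnBr expnS.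
  rewrite [X in (X * _ < _)%N]mulnCA -mulnA (_ : (2 - 1) ^ 2 * 2 = 2)%N //.
  by rewrite ltn_mul2l.
have pow_le k : (7 ^ k <= 16 ^ k)%N by case: k => // k; rewrite leq_exp2r.
have pow_mono k : ((2 ^ N.+1 - 1) * (2 ^ N - 1) * 7 ^ k < 16 ^ k)%N ->
    (k <= m)%N -> ((2 ^ N.+1 - 1) * (2 ^ N - 1) * 7 ^ m < 16 ^ m)%N.
  move=> ltk /subnKC <-; rewrite !expnD mulnA.
  apply: leq_ltn_trans (leq_mul (leqnn _) (pow_le (m - k)%N)) _.
  by rewrite ltn_mul2r expn_gt0 ltk.
have [N_ge4|] := leqP 4 N; last first.
  case: N N_gt0 mN pow_mono => [|[|[|[]]]] // _ mN pow_mono _.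
  - by refine (pow_mono 2 _ _)%N; lia.
  - by refine (pow_mono 4 _ _)%N; lia.
  - by refine (pow_mono 6 _ _)%N; lia.
(* Twentieth powers turn the exponent [m] into [20 * m], comparable with [39 * N] without
   fractions. *)
rewrite -(ltn_exp2r _ _ (isT : 0 < 20)%N).
(* (16 / 7) ^ 13 > 2 ^ 15. *)
have pow13 : (2 ^ (45 * N) * 7 ^ (39 * N) < 16 ^ (39 * N))%N.
  have -> : (45 * N = 15 * (3 * N))%N by lia.
  have -> : (39 * N = 13 * (3 * N))%N by lia.
  rewrite (expnM 2 15) (expnM 7 13) (expnM 16 13) -expnMn ltn_exp2r; last by lia.
  lia.
apply: (@leq_ltn_trans (2 ^ (45 * N) * 7 ^ (20 * m))).
  rewrite expnMn mulnC -expnM (mulnC m) [X in (_ <= X)%N]mulnC 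
    leq_mul2l; apply/orP; right.
  apply: (@leq_trans ((2 ^ (2 * N + 1)) ^ 20)).
    rewrite leq_exp2r // addn1 mul2n -addnn -addSn expnD leq_mul ?leq_subr //.
  by rewrite -expnM leq_exp2l //; lia.
rewrite -expnM (mulnC m) -(subnKC mN) (expnD 7 (39 * N)) (expnD 16 (39 * N)) mulnA.
apply: leq_ltn_trans (leq_mul (leqnn _) (pow_le _)) _.
by rewrite ltn_pmul2r // expn_gt0.
Qed.

Lemma line_bound_ge0 (R : realType) (q N : nat) :
  (0 < q)%N -> 0 <= line_bound R q N.
Proof.
move=> q_gt0.
rewrite /line_bound; case: ifP => _; rewrite ceil_ge0 (lt_le_trans (ltrN10 R)) //.
  by rewrite mulr_ge0 // divr_ge0.
by rewrite mulr_ge0 // divr_ge0 // addr_ge0 // divr_ge0 // mulr_ge0 ?sqr_ge0 //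
  ln_ge0 // ler1n.
Qed.

Lemma line_bound2 (R : realType) (N m : nat) :
  (line_bound R 2 N = m)%Z -> (39 * N <= 20 * m)%N.
Proof.
rewrite /line_bound eqxx => mE.
have := ceil_ge (195 / 100 * N%:R : R); rewrite mE => h.
rewrite -(ler_nat R) !natrM; move: h; rewrite -pmulrn; lra.
Qed.

(** In logarithms, each line gains at least [ln q + 1 / (q + 1) ^ 2], and the [m] lines together
    must offset [2 * N * ln q]. *)
Lemma line_bound_count (R : realType) (q N m : nat) :
  (2 < q)%N -> line_bound R q N = m%:Z ->
  ((q ^ N.+1 - 1) * (q ^ N.+1 - q) * ((q ^ 2 - 1) * q + 1) ^ m
   < (q - 1) ^ 2 * q * (q ^ 4) ^ m)%N.
Proof.
move=> q_gt2 bE; set p := ((q ^ 2 - 1) * q + 1)%N.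
(* The surplus factor [q ^ 2] in the number of pairs is absorbed by [(q - 1) ^ 2 * q], which is at
   least as large once [q] is at least 3. *)
suff pow_le : (q ^ (2 * N) * p ^ m <= (q ^ 4) ^ m)%N.
  have p_gt0 : (0 < p ^ m)%N by rewrite expn_gt0 /p addn1.
  apply: (@leq_trans (q ^ N.+1 * q ^ N.+1 * p ^ m)).
    rewrite ltn_mul2r p_gt0 /= -[X in (_ < X)%N]muln1.
    have : (q ^ 1 <= q ^ N.+1)%N by rewrite leq_exp2l //; lia.
    rewrite expn1; nia.
  have -> : (q ^ N.+1 * q ^ N.+1 * p ^ m = q ^ 2 * (q ^ (2 * N) * p ^ m))%N.
    by rewrite mulnA -!expnD; congr (_ ^ _ * _)%N; lia.
  apply: leq_mul pow_le; nia.
have qR : 3 <= q%:R :> R by rewrite ler_nat.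
have q0 : 0 < q%:R :> R by lra.
have L_gt0 : 0 < ln (q%:R : R) by rewrite ln_gt0 //; lra.
set L := ln (q%:R : R) in L_gt0 *.
set s : R := (q%:R + 1) ^+ 2.
have s_gt0 : 0 < s by rewrite exprn_gt0 //; lra.
have mN : 2 * N%:R * L <= m%:R * (L + s^-1).
  have := ceil_ge (2 / (1 + 1 / (L * s)) * N%:R).
  move: bE; rewrite /line_bound (gtn_eqF q_gt2) -/L -/s => -> /=.
  rewrite -pmulrn.
  have -> : 2 / (1 + 1 / (L * s)) * N%:R = (2 * N%:R * L) / (L + s^-1).
    have Ls_gt0 : 0 < L * s by rewrite mulr_gt0.
    field; rewrite !gt_eqF //=; lra.
  by rewrite ler_pdivrMr // addr_gt0 ?invr_gt0.
have p_gt0 : 0 < p%:R :> R by rewrite ltr0n /p addn1.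
(* Use [ln (1 - x) <= - x] with [x = (q - 1) / q ^ 3]; here [x] is at least [1 / (q + 1) ^ 2]
   because [(q - 1) * (q + 1) ^ 2 = q ^ 3 + q ^ 2 - q - 1]. *)
have lnp : ln (p%:R : R) <= 3 * L - s^-1.
  have pE : p%:R = q%:R ^+ 3 * (1 + - ((q%:R - 1) / q%:R ^+ 3)) :> R.
    rewrite /p natrD natrM natrB ?expn_gt0 ?natrX; last by lia.
    by field; rewrite gt_eqF.
  have e_lt1 : -1 < - ((q%:R - 1) / q%:R ^+ 3) :> R.
    rewrite ltrN2 ltr_pdivrMr ?exprn_gt0 // mul1r !exprS expr0.
    nra.
  rewrite pE lnM ?posrE ?exprn_gt0 //; last by lra.
  rewrite lnXn // -/L -[L *+ 3]mulr_natl lerD2l.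
  apply: le_trans (le_ln1Dx e_lt1) _; rewrite lerN2.
  rewrite ler_pdivlMr ?exprn_gt0 // mulrC ler_pdivrMr // /s.
  nra.
rewrite -(ler_nat R) natrM !natrX -ler_ln ?posrE; last 2 first.
- by rewrite mulr_gt0 ?exprn_gt0.
- by rewrite !exprn_gt0.
rewrite lnM ?posrE ?exprn_gt0 // !lnXn ?exprn_gt0 // -/L.
suff : L * (2 * N%:R) + ln p%:R * m%:R <= L * 4 * m%:R.
  by rewrite -natrM !mulr_natr.
have : m%:R * ln (p%:R : R) <= m%:R * (3 * L - s^-1) by rewrite ler_wpM2l.
move: mN; move: (s^-1) (ln p%:R) => t l; lra.
Qed.

(** * Assembly of the lines into the blocking set *)

Unset Implicit Arguments.

Theorem theorem4p1 (R : realType) (q N : nat) (F : finFieldType)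
    (card_F : #|F| = q) (N_gt0 : (0 < N)%N) :
  exists (S : {set pg_point F N}) (L : {set pg_line F N}),
    [/\ cutting_blocking_set S,
        S = \bigcup_(l in L) points_of l,
        (#|L|%:Z <= line_bound R q N)
      & (#|S|%:Z <= line_bound R q N * (q.+1)%:Z)].
Proof.
have q_gt1 : (1 < q)%N by rewrite -card_F card_finNzRing_gt1.
have := line_bound_ge0 R N (ltnW q_gt1).
case bE: (line_bound R q N) => [m|//] _.
have [W cutW] : exists W : {ffun 'I_m -> 'M[F]_(N.+1, 2)},
    forall f g : 'rV[F]_N.+1, indep f g ->
    exists i, ~~ multiple_of (f *m W i) (g *m W i).
  apply: exists_cutting_matrices; rewrite card_F.
  have [q2|q_neq2] := eqVneq q 2%N; last first.
    by apply: line_bound_count bE; rewrite ltn_neqAle eq_sym q_neq2.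
  by move: bE; rewrite q2 => /line_bound2; apply: line_bound2_count.
have [ell ellW] := fin_all_exists (fun i => line_containing (W i) N_gt0).
pose L := [set ell i | i : 'I_m].
(* Different indices may give the same line, hence only an inequality. *)
have cardL : (#|L| <= m)%N by rewrite -[leqRHS]card_ord leq_imset_card.
exists (\bigcup_(l in L) points_of l), L; split=> //.
  apply: (cutting_of_matrices N_gt0 cutW) => i w P PW.
  apply/bigcupP; exists (ell i); first exact: imset_f.
  by rewrite inE (subv_trans PW) // -memvE.
rewrite -PoszM lez_nat; apply: leq_trans (leq_mul cardL (leqnn _)).
rewrite -sum_nat_const -card_F.
apply: (big_ind2 (fun (A : {set pg_point F N}) k => #|A| <= k)%N) => [|A a B b Aa Bb|l _].
- by rewrite cards0.
- exact: leq_trans (leq_card_setU A B) (leq_add Aa Bb).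
- exact: card_points_of_line.
Qed.
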